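(* Every hyper-simple Lie algebra over $\mathbb R$ is isomorphic to $\mathfrak{so}(3,\mathbb R)$.
   Context: Lie algebras are finite-dimensional. A simple Lie algebra is called hyper-simple if all its proper subalgebras are abelian. *)

(* Defs.v *)
From HB Require Import structures.
From mathcomp Require Import all_boot all_order all_algebra.
From mathcomp Require Import ring.

Set Implicit Arguments.
Unset Strict Implicit.
Unset Printing Implicit Defensive.

Import GRing.Theory.
Local Open Scope ring_scope.

(* A vectType is finite-dimensional, so lieAlgType K is the type of
   finite-dimensional Lie algebras over K. *)
HB.mixin Record Vector_isLieAlgebra (K : fieldType) L & Vector K L := {
  lie : L -> L -> L;
  lie_linearl : forall y, linear (fun x => lie x y);
  lie_linearr : forall x, linear (lie x);
  liexx : forall x, lie x x = 0;
  lie_jacobi : forall x y z,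
    lie x (lie y z) + lie y (lie z x) + lie z (lie x y) = 0
}.

#[short(type="lieAlgType")]
HB.structure Definition LieAlgebra (K : fieldType) :=
  { L of Vector K L & Vector_isLieAlgebra K L }.

Section LieTheory.
Context (K : fieldType) (L : lieAlgType K).
Implicit Types U : {vspace L}.

Definition is_subalgebra U : Prop :=
  forall x y, x \in U -> y \in U -> lie x y \in U.

Definition is_ideal U : Prop := forall x y, y \in U -> lie x y \in U.

Definition is_abelian U : Prop :=
  forall x y, x \in U -> y \in U -> lie x y = 0.

End LieTheory.

(* Non-abelianness excludes the algebras of dimension 0 and 1. *)
Definition simple_lie (K : fieldType) (L : lieAlgType K) : Prop :=
  ~ is_abelian (fullv : {vspace L}) /\
  forall I : {vspace L}, is_ideal I -> I = 0%VS \/ I = fullv.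

Definition hyper_simple (K : fieldType) (L : lieAlgType K) : Prop :=
  simple_lie L /\
  forall U : {vspace L}, is_subalgebra U -> U <> fullv -> is_abelian U.

Definition lie_isomorphic (K : fieldType) (L M : lieAlgType K) : Prop :=
  exists f : {linear L -> M},
    bijective f /\ forall x y, f (lie x y) = lie (f x) (f y).

Section SpecialOrthogonal.
Context (K : fieldType) (n : nat).
Implicit Types A B C : 'M[K]_n.

Definition mxcomm A B : 'M[K]_n := A *m B - B *m A.

Fact mxcomm_linearl B : linear (fun A => mxcomm A B).
Proof.
move=> a A C; rewrite /mxcomm mulmxDl mulmxDr -scalemxAl -scalemxAr.
by rewrite opprD addrACA scalerBr.
Qed.

Fact mxcomm_linearr A : linear (mxcomm A).
Proof.
move=> a B C; rewrite /mxcomm mulmxDl mulmxDr -scalemxAl -scalemxAr.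
by rewrite opprD addrACA scalerBr.
Qed.

Fact mxcommxx A : mxcomm A A = 0.
Proof. exact: subrr. Qed.

Fact mxcomm_jacobi A B C :
  mxcomm A (mxcomm B C) + mxcomm B (mxcomm C A) + mxcomm C (mxcomm A B) = 0.
Proof.
rewrite /mxcomm !mulmxBl !mulmxBr !mulmxA !opprB.
move: (A *m B *m C) (A *m C *m B) (B *m A *m C) (B *m C *m A)
  (C *m A *m B) (C *m B *m A) => a b c d e f.
apply/matrixP=> i j; rewrite !mxE.
move: (a i j) (b i j) (c i j) (d i j) (e i j) (f i j) => {}a {}b {}c {}d {}e {}f.
by rewrite ?opprB; ring.
Qed.

(* Twice the symmetric part; its kernel consists of the skew-symmetric matrices,
   which form so(n) when K has characteristic other than 2. *)
Definition sym_part A : 'M[K]_n := A + A^T.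

Fact sym_part_linear : linear sym_part.
Proof.
by move=> a A B; rewrite /sym_part linearP /= scalerDr addrACA.
Qed.

HB.instance Definition _ :=
  GRing.isLinear.Build K 'M[K]_n 'M[K]_n _ sym_part sym_part_linear.

Definition skew_space : {vspace 'M[K]_n} := lker (linfun sym_part).

Lemma skew_spaceE A : (A \in skew_space) = (A^T == - A).
Proof. by rewrite memv_ker lfunE /= /sym_part addrC addr_eq0. Qed.

Fact mxcomm_skew A B :
  A \in skew_space -> B \in skew_space -> mxcomm A B \in skew_space.
Proof.
rewrite !skew_spaceE => /eqP sA /eqP sB; apply/eqP.
by rewrite /mxcomm linearB /= !trmx_mul sA sB !mulmxN !mulNmx !opprK opprB.
Qed.

Definition so := subvs_of skew_space.
HB.instance Definition _ := Vector.on so.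

Definition so_lie (u v : so) : so := Subvs (mxcomm_skew (subvsP u) (subvsP v)).

Fact so_lie_linearl v : linear (fun u => so_lie u v).
Proof. by move=> a u w; apply: val_inj; apply: mxcomm_linearl. Qed.

Fact so_lie_linearr u : linear (so_lie u).
Proof. by move=> a v w; apply: val_inj; apply: mxcomm_linearr. Qed.

Fact so_liexx u : so_lie u u = 0.
Proof. by apply: val_inj; apply: mxcommxx. Qed.

Fact so_lie_jacobi u v w :
  so_lie u (so_lie v w) + so_lie v (so_lie w u) + so_lie w (so_lie u v) = 0.
Proof. by apply: val_inj; apply: mxcomm_jacobi. Qed.

HB.instance Definition _ := Vector_isLieAlgebra.Build K so
  so_lie_linearl so_lie_linearr so_liexx so_lie_jacobi.

End SpecialOrthogonal.

Arguments so K n : clear implicits.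

(* Main.v *)
From HB Require Import structures.
Require Import Defs.
From mathcomp Require Import all_boot all_order all_algebra.
From mathcomp Require Import reals.
From mathcomp Require Import complex ring.

(** Let x be a nonzero element of a hyper-simple algebra L and let Z be its
    centralizer; write {u, v} for the Lie bracket.  As L has trivial center, Z is
    a proper subalgebra, hence abelian; therefore every nonzero element of Z has
    centralizer Z.  Moreover Z is its own normalizer: a normalizing y outside Z
    would make Z + <y> a non-abelian subalgebra, so all of L, and Z an ideal.

    The commuting operators ad k, for k in Z, act on L / Z and have a common
    eigenvector over the complex numbers.  Since Z is abelian, applying ad x to
    any lift of it produces a common eigenvector y + i z in the complexification
    of L itself ([weight_pair_exists]); it does not lie in that of Z, because Z
    is self-normalizing.

    Two facts then determine the brackets.  No ad k has a nonzero real
    eigenvalue, for otherwise k and the eigenvector would span a non-abelian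
    subalgebra with an ideal of dimension 1 ([eigenvalue_eq0]).  And if k acts on
    y + i z by a + i b, then {y, z} satisfies the eigenvector equation of ad k
    for 2 a.  Now {y, z} is nonzero, as otherwise Z, y and z would span L and the
    span of y and z would be an abelian ideal.  So every a vanishes, {y, z} lies
    in Z, the span of Z, y and z is a non-abelian subalgebra, hence L.  Only 0
    in Z commutes with y and z, so an element of Z is determined by its b, and Z
    is the line of x ([rotation_basis]).

    This leaves {x, y} = - b z, {x, z} = b y and {y, z} = c x.  The sign of b c
    distinguishes so(3) from sl(2); in the latter ad y has a nonzero real
    eigenvalue ([rotation_sign]).  For the other sign a rescaling gives the cross
    product, which is so(3) ([of_so3_lie]). *)

Set Implicit Arguments.
Unset Strict Implicit.
Unset Printing Implicit Defensive.

Import Order.TTheory GRing.Theory Num.Theory.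
Import VectorInternalTheory.
Local Open Scope ring_scope.

(** * Common complex eigenvectors of real operators *)

Section CommonEigenpair.
Variable R : rcfType.
Local Notation C := R[i]%C.
Local Notation toC := (real_complex R).
Local Notation Re := (@complex.Re R).
Local Notation Im := (@complex.Im R).

(** The real form of f (y + i z) = (a + i b) (y + i z). *)
Definition is_eigenpair (M : lmodType R) (f : M -> M) (y z : M) :=
  exists a b : R, f y = a *: y - b *: z /\ f z = b *: y + a *: z.

Lemma map_Re_mulmx m n (v : 'M[C]_(m, n)) p (A : 'M[R]_(n, p)) :
  map_mx Re (v *m map_mx toC A) = map_mx Re v *m A.
Proof.
apply/matrixP=> i j; rewrite !mxE raddf_sum; apply: eq_bigr => k _.
by rewrite !mxE /=; case: (v i k) => a b /=; rewrite mulr0 subr0.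
Qed.

Lemma map_Im_mulmx m n (v : 'M[C]_(m, n)) p (A : 'M[R]_(n, p)) :
  map_mx Im (v *m map_mx toC A) = map_mx Im v *m A.
Proof.
apply/matrixP=> i j; rewrite !mxE raddf_sum; apply: eq_bigr => k _.
by rewrite !mxE /=; case: (v i k) => a b /=; rewrite mulr0 add0r.
Qed.

(** Complexification, in coordinates, of the existence of a common eigenvector
    for commuting matrices over an algebraically closed field. *)
Lemma common_eigenpair (M : vectType R) (fs : seq 'End(M)) :
  (fullv : {vspace M}) <> 0%VS ->
  (forall f g : 'End(M), f \in fs -> g \in fs -> forall v, f (g v) = g (f v)) ->
  exists y z : M, ~ (y = 0 /\ z = 0) /\
    forall f : 'End(M), f \in fs -> is_eigenpair f y z.
Proof.
move=> M_neq0 fs_comm.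
have dimM : (0 < dim M)%N.
  by rewrite -dimvf lt0n dimv_eq0; apply/eqP.
pose mx (f : 'End(M)) : 'M[R]_(dim M) := lin1_mx (v2r \o f \o r2v).
have mxP f (u : 'rV_(dim M)) : r2v (u *m mx f) = f (r2v u).
  by rewrite mul_rV_lin1 /= v2rK.
pose As := [seq map_mx toC (mx f) | f <- fs].
have [|v v_neq0 /allP v_stable] := spectral.common_eigenvector (As := As) dimM.
  move=> _ _ /mapP[f fsf ->] /mapP[g fsg ->].
  rewrite /comm_mx -!map_mxM; congr map_mx.
  apply/row_matrixP=> i; rewrite !rowE; apply: (can_inj r2vK).
  by rewrite !mulmxA !mxP fs_comm.
exists (r2v (map_mx Re v)), (r2v (map_mx Im v)); split.
  case=> /(canRL r2vK); rewrite linear0 => Rev0.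
  move=> /(canRL r2vK); rewrite linear0 => Imv0.
  case/eqP: v_neq0; apply/rowP=> i.
  move/rowP/(_ i): Rev0; move/rowP/(_ i): Imv0; rewrite !mxE.
  by case: (v 0 i) => a b /= -> ->.
move=> f fsf.
have /v_stable/sub_rVP[[a b] vE] :=
  map_f (fun f => map_mx toC (mx f)) fsf.
exists a, b; rewrite -!mxP -map_Re_mulmx -map_Im_mulmx vE.
rewrite -!linearZ -linearB -linearD.
by split; congr r2v; apply/rowP=> i; rewrite !mxE; case: (v 0 i) => c d //=;
  rewrite addrC.
Qed.
End CommonEigenpair.

(** * Brackets and centralizers *)

Section LieBasics.
Variables (K : fieldType) (L : lieAlgType K).
Implicit Types (x y z : L).

HB.instance Definition _ x :=
  GRing.isLinear.Build K L L _ (lie x) (lie_linearr x).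

Lemma lieDl x y z : lie (x + y) z = lie x z + lie y z.
Proof. by have := lie_linearl z 1 x y; rewrite !scale1r. Qed.

Lemma lieDr x y z : lie x (y + z) = lie x y + lie x z.
Proof. exact: linearD. Qed.

Lemma lieZr a x y : lie x (a *: y) = a *: lie x y.
Proof. exact: linearZ. Qed.

Lemma lie0r x : lie x 0 = 0.
Proof. exact: linear0. Qed.

Lemma lie_anti x y : lie x y = - lie y x.
Proof.
have := liexx (x + y).
by rewrite lieDl !lieDr !liexx add0r addr0 => /eqP; rewrite addr_eq0 => /eqP.
Qed.

Lemma lieZl a x y : lie (a *: x) y = a *: lie x y.
Proof. by rewrite lie_anti lieZr -scalerN -lie_anti. Qed.

Lemma lie_derivation x y z :
  lie x (lie y z) = lie (lie x y) z + lie y (lie x z).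
Proof.
have := lie_jacobi x y z.
rewrite [lie z (lie x y)]lie_anti [lie z x]lie_anti linearN.
by move/eqP; rewrite subr_eq0 subr_eq => /eqP ->.
Qed.

Lemma lie_commuting x y z : lie x y = 0 -> lie x (lie y z) = lie y (lie x z).
Proof. by move=> xy; rewrite lie_derivation xy lie_anti lie0r oppr0 add0r. Qed.

Definition centralizer x : {vspace L} := lker (linfun (lie x)).

Lemma centralizerP x y : reflect (lie x y = 0) (y \in centralizer x).
Proof. by rewrite memv_ker lfunE; apply: eqP. Qed.

Lemma mem_centralizer x : x \in centralizer x.
Proof. exact/centralizerP/liexx. Qed.

Lemma centralizer_subalgebra x : is_subalgebra (centralizer x).
Proof.
move=> u v /centralizerP xu /centralizerP xv.
by apply/centralizerP; rewrite lie_commuting // xv lie0r.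
Qed.

Lemma line_abelian x : is_abelian <[x]>%VS.
Proof.
by move=> _ _ /vlineP[a ->] /vlineP[b ->]; rewrite lieZl lieZr liexx !scaler0.
Qed.
End LieBasics.

(** * Centralizers in hyper-simple algebras *)

Section HyperSimple.
Variables (K : fieldType) (L : lieAlgType K).
Hypothesis hL : hyper_simple L.
Implicit Types (x y z : L) (U I : {vspace L}).

Lemma subalgebra_eq_full U x y :
  is_subalgebra U -> x \in U -> y \in U -> lie x y != 0 -> U = fullv.
Proof.
move=> subU Ux Uy xy_neq0; apply/eqP; apply: contraNT xy_neq0 => /eqP U_proper.
by apply/eqP; apply: hL.2 U_proper _ _ Ux Uy.
Qed.

Lemma abelian_ideal_trivial I v :
  is_ideal I -> is_abelian I -> v \in I -> v = 0.
Proof.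
case: hL => -[nab simpleL] _ /simpleL[-> _|-> /nab//].
by rewrite memv0 => /eqP.
Qed.

(** Otherwise x and v span a non-abelian subalgebra, hence L, in which the line of
    v is an ideal. *)
Lemma eigenvalue_eq0 x v c : lie x v = c *: v -> v != 0 -> c = 0.
Proof.
move=> xv v_neq0; apply/eqP; apply: contraT => c_neq0.
have brU a b a' b' :
    lie (a *: x + b *: v) (a' *: x + b' *: v) = ((a * b' - b * a') * c) *: v.
  rewrite !lieDr !lieDl !lieZr !lieZl !liexx !scaler0 add0r addr0.
  rewrite [lie v x]lie_anti xv -scaleNr !scalerA -scalerDl.
  by congr (_ *: _); ring.
have full : (<[x]> + <[v]>)%VS = fullv.
  apply: (@subalgebra_eq_full _ x v).
  - move=> ? ? /memv_addP[_ /vlineP[a ->] [_ /vlineP[b ->] ->]].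
    move=> /memv_addP[_ /vlineP[a' ->] [_ /vlineP[b' ->] ->]].
    by rewrite brU rpredZ // (subvP (addvSr _ _)) // memv_line.
  - by rewrite (subvP (addvSl _ _)) // memv_line.
  - by rewrite (subvP (addvSr _ _)) // memv_line.
  - by rewrite xv scaler_eq0 negb_or c_neq0.
case/eqP: v_neq0.
apply: abelian_ideal_trivial (@line_abelian _ _ v) (memv_line v).
move=> w _ /vlineP[d ->].
have := memvf w; rewrite -full.
case/memv_addP=> _ /vlineP[a ->] [_ /vlineP[b ->] ->].
by rewrite -[d *: v]add0r -(scale0r x) brU rpredZ // memv_line.
Qed.

Section Centralizer.
Variable x : L.
Hypothesis x_neq0 : x != 0.

Lemma centralizer_neq_full : centralizer x <> fullv.
Proof.
move=> full; case/eqP: x_neq0.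
have central w : lie x w = 0 by apply/centralizerP; rewrite full memvf.
apply: abelian_ideal_trivial (@line_abelian _ _ x) (memv_line x).
by move=> w _ /vlineP[d ->]; rewrite lieZr lie_anti central oppr0 scaler0 mem0v.
Qed.

Lemma centralizer_abelian : is_abelian (centralizer x).
Proof. exact: hL.2 (@centralizer_subalgebra _ _ x) centralizer_neq_full. Qed.
End Centralizer.

(** The centralizer of h is abelian and contains both x and y. *)
Lemma centralizer_trans x h y :
  h \in centralizer x -> h != 0 -> lie h y = 0 -> y \in centralizer x.
Proof.
move=> /centralizerP xh h_neq0 hy; apply/centralizerP.
apply: (centralizer_abelian h_neq0); apply/centralizerP => //.
by rewrite lie_anti xh oppr0.
Qed.

(** If y were outside, the centralizer and y would span a non-abelian subalgebra,
    so all of L; the centralizer would then be an abelian ideal. *)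
Lemma centralizer_self_normalizing x y : x != 0 ->
  (forall k, k \in centralizer x -> lie k y \in centralizer x) ->
  y \in centralizer x.
Proof.
set Z := centralizer x => x_neq0 norm_y.
apply/centralizerP/eqP; apply: contraT => xy_neq0.
have ZZ : is_abelian Z := centralizer_abelian x_neq0.
have Zx : x \in Z := mem_centralizer x.
have full : (Z + <[y]>)%VS = fullv.
  apply: (@subalgebra_eq_full _ x y) => //.
  - move=> ? ? /memv_addP[h Zh [_ /vlineP[a ->] ->]].
    move=> /memv_addP[k Zk [_ /vlineP[b ->] ->]].
    apply: (subvP (addvSl _ _)).
    rewrite !lieDr !lieDl !lieZr !lieZl liexx !scaler0 addr0.
    by rewrite ZZ // add0r [lie y k]lie_anti rpredD // rpredZ // ?rpredN norm_y.
  - exact: (subvP (addvSl _ _)).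
  - by rewrite (subvP (addvSr _ _)) // memv_line.
case/eqP: x_neq0; apply: (@abelian_ideal_trivial Z) => // w k Zk.
have := memvf w; rewrite -full => /memv_addP[h Zh [_ /vlineP[a ->] ->]].
by rewrite lieDl lieZl ZZ // add0r lie_anti rpredZ // rpredN norm_y.
Qed.
End HyperSimple.

(** * A common complex eigenvector of a centralizer *)

Section WeightPair.
Variables (R : rcfType) (L : lieAlgType R).
Hypothesis hL : hyper_simple L.
Variable x : L.
Hypothesis x_neq0 : x != 0.
Let Z := centralizer x.

Lemma eigenpair_span (fs : seq L) y z :
  (forall k, k \in fs -> is_eigenpair (lie k) y z) ->
  forall k, k \in <<fs>>%VS -> is_eigenpair (lie k) y z.
Proof.
move=> fs_pair k; rewrite -[fs]/(tval (in_tuple fs)) => /coord_span ->.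
apply: (big_ind (fun k => is_eigenpair (lie k) y z)).
- by exists 0, 0; rewrite !scale0r ![lie 0 _]lie_anti !lie0r oppr0 addr0.
- move=> k1 k2 [a1 [b1 [y1 z1]]] [a2 [b2 [y2 z2]]]; exists (a1 + a2), (b1 + b2).
  rewrite !lieDl y1 y2 z1 z2 !scalerDl opprD addrACA; split=> //.
  by rewrite addrACA.
- move=> i _; have [|a [b [ky kz]]] := fs_pair fs`_i; first exact: mem_nth.
  move: (coord _ _ _) => t; exists (t * a), (t * b).
  by rewrite !lieZl ky kz scalerBr scalerDr !scalerA.
Qed.

(** Z acts on L / Z, realised as a complement C of Z on which k acts by ad k
    followed by the projection P along Z.  A common eigenvector y + i z there
    satisfies the eigenvector equations in L up to terms of Z; applying ad x
    kills these terms and commutes with every ad k. *)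
Lemma weight_pair_exists : exists y z : L, ~ (y \in Z /\ z \in Z) /\
  forall k, k \in Z -> is_eigenpair (lie k) y z.
Proof.
pose C := (Z^C)%VS.
have [P PE] : exists P : 'End(L), forall v, P v = v - projv Z v.
  by exists (\1 - projv Z)%VF => v; rewrite !lfunE /= !lfunE.
have PC v : P v \in C by rewrite PE memv_projC.
have modP v : v - P v \in Z by rewrite PE opprB addrC subrK memv_proj.
have ZZ : is_abelian Z by apply: centralizer_abelian.
pose T k : 'End(subvs_of C) :=
  (linfun (vsproj C) \o P \o linfun (lie k) \o linfun vsval)%VF.
have TE k u : vsval (T k u) = P (lie k (vsval u)).
  by rewrite !comp_lfunE ![linfun _ _]lfunE /= vsprojK ?PC.
have P_lie k v : k \in Z -> P (lie k (P v)) = P (lie k v).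
  move=> Zk; rewrite -[in RHS](subrK (P v) v) lieDr linearD /=.
  by rewrite (ZZ k (v - P v)) ?linear0 ?add0r.
have [||y [z [yz_neq0 eig]]] := @common_eigenpair R _ (map T (vbasis Z)).
- move=> full.
  have : Z = fullv.
    apply/eqP; rewrite eqEsubv subvf; apply/subvP=> v _.
    suff -> : v = v - P v by exact: modP.
    have : vsproj C (P v) \in (fullv : {vspace subvs_of C}) by exact: memvf.
    rewrite full memv0 => /eqP/(congr1 vsval).
    by rewrite vsprojK // linear0 => ->; rewrite subr0.
  exact: centralizer_neq_full.
- move=> _ _ /mapP[k /vbasis_mem Zk ->] /mapP[l /vbasis_mem Zl ->] v.
  apply: val_inj; rewrite /= !TE !P_lie //.
  by rewrite (lie_commuting _ (ZZ k l Zk Zl)).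
have lie_xP v : lie x (P v) = lie x v.
  by rewrite PE linearB /= (centralizerP _ _ (memv_proj _ _)) subr0.
pose y' := lie x (vsval y); pose z' := lie x (vsval z).
have ZC (v : subvs_of C) : vsval v \in Z -> v = 0.
  move=> Zv; have : vsval v \in (Z :&: C)%VS by rewrite memv_cap Zv subvsP.
  by rewrite capv_compl memv0 => /eqP v0; apply: val_inj.
have pair : forall k, k \in Z -> is_eigenpair (lie k) y' z'.
  rewrite -(span_basis (vbasisP Z)); apply: eigenpair_span => k fs_k.
  have Zk := vbasis_mem fs_k.
  have lie_kx v : lie k (lie x v) = lie x (P (lie k v)).
    by rewrite lie_xP lie_commuting // ZZ // mem_centralizer.
  have [a [b [/(congr1 vsval) ky /(congr1 vsval) kz]]] := eig _ (map_f T fs_k).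
  exists a, b; rewrite !lie_kx -!TE ky kz.
  by rewrite !linearB !linearD !linearZ.
exists y', z'; split=> // -[Zy' Zz']; apply: yz_neq0.
(* If lie x v commutes with all of Z, then x commutes with every lie k v, so that
   v normalizes Z. *)
have Z_of v : lie x v \in Z -> v \in Z.
  move=> Zxv; apply: centralizer_self_normalizing => // k Zk; apply/centralizerP.
  by rewrite (lie_commuting _ (ZZ x k (mem_centralizer x) Zk)) ZZ.
by split; apply: ZC; apply: Z_of.
Qed.
End WeightPair.

(** * A basis and its brackets *)

Section Structure.
Variables (R : rcfType) (L : lieAlgType R).
Hypothesis hL : hyper_simple L.

(** For the common eigenvector y + i z of the centralizer of x, every k there
    scales lie y z by twice the real part of its eigenvalue.  Once lie y z is
    known to be nonzero, all eigenvalues are purely imaginary. *)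
Lemma rotation_basis : exists (x y z : L) (b c : R),
  [/\ x != 0, b != 0 & c != 0] /\
  [/\ lie x y = - b *: z, lie x z = b *: y, lie y z = c *: x &
    forall v, exists p q r, v = p *: x + q *: y + r *: z].
Proof.
have [x x_neq0] : exists x : L, x != 0.
  exists (vpick fullv); rewrite vpick0; apply/eqP=> full0.
  case: hL => -[nab _] _; case: nab => u v _ _.
  by have := memvf (lie u v); rewrite full0 memv0 => /eqP.
have [y [z [yz_notin pair]]] := weight_pair_exists hL x_neq0.
pose Z := centralizer x; rewrite -/Z in yz_notin pair.
have Zx : x \in Z := mem_centralizer x.
have ZZ : is_abelian Z := centralizer_abelian hL x_neq0.
have weight_neq0 k a b : k \in Z -> k != 0 ->
    lie k y = a *: y - b *: z -> lie k z = b *: y + a *: z ->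
    ~ (a = 0 /\ b = 0).
  move=> Zk k_neq0 ky kz [a0 b0]; apply: yz_notin.
  move: ky kz; rewrite a0 b0 !scale0r subr0 addr0 => ky kz.
  by split; apply: centralizer_trans Zk k_neq0 _.
have [a [b [xy xz]]] := pair x Zx.
(* Otherwise a is nonzero and y or z is a real eigenvector of ad x for it. *)
have b_neq0 : b != 0.
  apply/eqP=> b0; move: (xy) (xz); rewrite b0 !scale0r subr0 add0r => xy' xz'.
  have a_neq0 : a != 0.
    by apply/eqP=> a0; apply: weight_neq0 Zx x_neq0 xy xz _.
  apply: yz_notin; split; apply: contraT => notin.
    case/eqP: a_neq0; apply: (eigenvalue_eq0 hL xy').
    by apply: contraNneq notin => ->; apply: mem0v.
  case/eqP: a_neq0; apply: (eigenvalue_eq0 hL xz').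
  by apply: contraNneq notin => ->; apply: mem0v.
(* A derivation acts on the exterior square of a plane by its trace. *)
have lie_w k a' b' :
    lie k y = a' *: y - b' *: z -> lie k z = b' *: y + a' *: z ->
    lie k (lie y z) = (2 * a') *: lie y z.
  move=> ky kz; rewrite lie_derivation ky kz lieDl lieDr -scaleNr.
  rewrite !lieZl !lieZr !liexx.
  by rewrite !scaler0 addr0 add0r -scalerDl -mulr2n mulr_natl.
pose I := (<[y]> + <[z]>)%VS.
have Iy : y \in I by rewrite (subvP (addvSl _ _)) // memv_line.
have Iz : z \in I by rewrite (subvP (addvSr _ _)) // memv_line.
have lie_kI k u : k \in Z -> u \in I -> lie k u \in I.
  move=> Zk /memv_addP[_ /vlineP[q ->] [_ /vlineP[r ->] ->]].
  have [a' [b' [ky kz]]] := pair k Zk.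
  by rewrite lieDr !lieZr ky kz rpredD // rpredZ // ?rpredB ?rpredD // rpredZ.
have lie_II u v : u \in I -> v \in I -> exists t, lie u v = t *: lie y z.
  move=> /memv_addP[_ /vlineP[q ->] [_ /vlineP[r ->] ->]].
  move=> /memv_addP[_ /vlineP[q' ->] [_ /vlineP[r' ->] ->]].
  exists (q * r' - r * q').
  rewrite !lieDr !lieDl !lieZr !lieZl !liexx !scaler0 add0r addr0
    [lie z y]lie_anti.
  by rewrite !scalerN !scalerA -scaleNr -scalerDl addrC; congr (_ *: _); ring.
have full_of : lie y z \in Z -> (Z + I)%VS = fullv.
  move=> Zw.
  have [SZ SI] : {subset Z <= (Z + I)%VS} /\ {subset I <= (Z + I)%VS}.
    by split; apply/subvP; [apply: addvSl|apply: addvSr].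
  have subS : is_subalgebra (Z + I)%VS.
    move=> ? ? /memv_addP[h Zh [u Iu ->]] /memv_addP[k Zk [v Iv ->]].
    have [t uv] := lie_II u v Iu Iv.
    rewrite !lieDr !lieDl ZZ // add0r uv [lie u k]lie_anti.
    apply: rpredD; first by rewrite rpredN SI // lie_kI.
    by apply: rpredD; [rewrite SI // lie_kI | rewrite rpredZ // SZ].
  have [xy0|] := eqVneq (lie x y) 0; last first.
    exact: (subalgebra_eq_full hL subS (SZ _ Zx) (SI _ Iy)).
  have [xz0|] := eqVneq (lie x z) 0; last first.
    exact: (subalgebra_eq_full hL subS (SZ _ Zx) (SI _ Iz)).
  by case: yz_notin; split; apply/centralizerP.
have w_neq0 : lie y z != 0.
  apply/eqP=> w0; have full := full_of _; rewrite w0 mem0v in full.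
  have II : is_abelian I.
    by move=> u v Iu Iv; have [t ->] := lie_II u v Iu Iv; rewrite w0 scaler0.
  have ideal : is_ideal I.
    move=> v u Iu; have := memvf v; rewrite -full //.
    case/memv_addP=> k Zk [v' Iv' ->].
    by rewrite lieDl (II v') // addr0 lie_kI.
  have I0 := abelian_ideal_trivial hL ideal II.
  by apply: yz_notin; rewrite (I0 _ Iy) (I0 _ Iz) mem0v.
have a0 : a = 0.
  have := eigenvalue_eq0 hL (lie_w x a b xy xz) w_neq0.
  by move/eqP; rewrite mulf_eq0 pnatr_eq0 /= => /eqP.
have Zw : lie y z \in Z.
  by apply/centralizerP; rewrite (lie_w x a b) // a0 mulr0 scale0r.
have full := full_of Zw.
have line k : k \in Z -> exists t, k = t *: x.
  move=> Zk; have [a' [b' [ky kz]]] := pair k Zk.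
  have a'0 : a' = 0.
    have /eqP := lie_w k a' b' ky kz.
    rewrite ZZ // eq_sym scaler_eq0 (negPf w_neq0).
    by rewrite orbF mulf_eq0 pnatr_eq0 /= => /eqP.
  (* The difference k - (b' / b) x kills both y and z. *)
  exists (b' / b); apply/eqP; rewrite -subr_eq0; apply: contraT => nz.
  case: (@weight_neq0 (k - (b' / b) *: x) 0 0) => //.
  - by rewrite rpredB // rpredZ.
  - by rewrite -scaleNr lieDl lieZl ky xy a0 a'0 !scale0r !sub0r oppr0
      scalerN scalerA mulNr divfK // scaleNr opprK addNr.
  - by rewrite -scaleNr lieDl lieZl kz xz a0 a'0 !scale0r !addr0
      scalerA mulNr divfK // scaleNr subrr.
have [c wE] := line _ Zw.
exists x, y, z, b, c; split.
  by split=> //; apply: contraNneq w_neq0 => c0; rewrite wE c0 scale0r.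
split=> //.
- by rewrite xy a0 scale0r sub0r scaleNr.
- by rewrite xz a0 scale0r addr0.
move=> v; have := memvf v; rewrite -full.
case/memv_addP=> h /line[p ->] [u Iu ->].
have /memv_addP[_ /vlineP[q ->] [_ /vlineP[r ->] ->]] := Iu.
by exists p, q, r; rewrite addrA.
Qed.

(** If b c were positive, z + t x with t = sqrt (c / b) would be an eigenvector of
    ad y for the nonzero real value t b. *)
Lemma rotation_sign (x y z : L) (b c : R) : x != 0 -> b != 0 -> c != 0 ->
  lie x y = - b *: z -> lie x z = b *: y -> lie y z = c *: x -> b * c < 0.
Proof.
move=> x_neq0 b_neq0 c_neq0 xy xz yz.
rewrite lt_neqAle mulf_neq0 //= leNgt; apply/negP=> bc_gt0.
have cb_gt0 : 0 < c / b.
  have ->: c / b = (b * c) / b ^+ 2 by field.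
  by rewrite divr_gt0 // exprn_even_gt0.
pose t := Num.sqrt (c / b).
have t_neq0 : t != 0 by rewrite gt_eqF // sqrtr_gt0.
have ct : c = t * t * b by rewrite -expr2 sqr_sqrtr ?ltW // divfK.
have y_eig : lie y (z + t *: x) = (t * b) *: (z + t *: x).
  rewrite lieDr lieZr yz [lie y x]lie_anti xy scaleNr opprK ct scalerDr.
  by rewrite !scalerA addrC; congr (_ *: _ + _ *: _); ring.
have v_neq0 : z + t *: x != 0.
  apply: contra_neq x_neq0 => /eqP; rewrite addr_eq0 => /eqP z_x.
  have /eqP : b *: y = 0 by rewrite -xz z_x -scaleNr lieZr liexx scaler0.
  rewrite scaler_eq0 (negPf b_neq0) => /eqP y0.
  have /eqP : c *: x = 0 by rewrite -yz y0 lie_anti lie0r oppr0.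
  by rewrite scaler_eq0 (negPf c_neq0) => /eqP.
have /eqP := eigenvalue_eq0 hL y_eig v_neq0.
by rewrite mulf_eq0 (negPf t_neq0) (negPf b_neq0).
Qed.
End Structure.

(** * The cross product and so(3) *)

Section CrossProduct.
Variables (K : realFieldType) (L : lieAlgType K) (e1 e2 e3 : L).
Hypotheses (e12 : lie e1 e2 = e3) (e23 : lie e2 e3 = e1) (e31 : lie e3 e1 = e2).

Definition of_so3 (A : so K 3) : L :=
  vsval A 2%:R 1 *: e1 + vsval A 0 2%:R *: e2 + vsval A 1 0 *: e3.

Fact of_so3_linear : linear of_so3.
Proof.
move=> a A B; rewrite /of_so3 /= !mxE !scalerDl -!scalerA !scalerDr.
by rewrite (addrACA (a *: _)) (addrACA (_ + _)).
Qed.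

HB.instance Definition _ :=
  GRing.isLinear.Build K (so K 3) L _ of_so3 of_so3_linear.

Lemma so3_entry (A : so K 3) i j : vsval A j i = - vsval A i j.
Proof.
have := subvsP A; rewrite skew_spaceE => /eqP/matrixP/(_ i j).
by rewrite !mxE.
Qed.

Lemma so3_diag (A : so K 3) i : vsval A i i = 0.
Proof.
have /eqP := so3_entry A i i.
by rewrite -subr_eq0 opprK -mulr2n mulrn_eq0 => /eqP.
Qed.

(** A skew matrix acts on 3-space as the cross product with the vector of its
    entries (2, 1), (0, 2), (1, 0), and this turns commutators into cross
    products. *)
Lemma of_so3_lie A B : of_so3 (lie A B) = lie (of_so3 A) (of_so3 B).
Proof.
have o1 : lift ord0 ord0 = 1 :> 'I_3 by apply: val_inj.
have o2 : lift ord0 (lift ord0 ord0) = 2%:R :> 'I_3 by apply: val_inj.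
rewrite /of_so3 /= !lieDr !lieDl !lieZr !lieZl !liexx.
rewrite [lie e2 e1]lie_anti [lie e3 e2]lie_anti [lie e1 e3]lie_anti e12 e23 e31.
rewrite !scaler0 add0r !addr0 !scalerA !scalerN -!scaleNr.
rewrite [RHS](AC (2*2*2) (4*6*(2*5)*(1*3)))%AC /= -!scalerDl.
rewrite /mxcomm !mxE !big_ord_recl !big_ord0 /= o1 o2.
rewrite !(so3_diag, so3_entry _ 1 0, so3_entry _ 0 2%:R, so3_entry _ 2%:R 1).
by congr (_ *: _ + _ *: _ + _ *: _); ring.
Qed.

Lemma of_so3_inj : e1 != 0 -> injective of_so3.
Proof.
move=> e1_neq0; apply: raddf_inj => A; rewrite /= /of_so3 => A0.
have e1_free t : t *: e1 = 0 -> t = 0.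
  by move=> /eqP; rewrite scaler_eq0 (negPf e1_neq0) orbF => /eqP.
(* Bracketing a relation twice isolates the coefficients of e2 and e3. *)
have := congr1 (lie e1) A0.
rewrite !lieDr !lieZr liexx e12 [lie e1 e3]lie_anti e31 scaler0 add0r lie0r.
rewrite scalerN -scaleNr => B0.
have := congr1 (lie e2) B0.
rewrite lieDr !lieZr e23 liexx scaler0 addr0 lie0r => /e1_free q0.
have := congr1 (lie e3) B0.
rewrite lieDr !lieZr liexx [lie e3 e2]lie_anti e23 scaler0 add0r lie0r.
rewrite scalerN scaleNr opprK => /e1_free r0.
rewrite q0 r0 !scale0r !addr0 in A0; have p0 := e1_free _ A0.
have ord3 (i : 'I_3) : [\/ i = 0, i = 1 | i = 2%:R].
  by case: i => [[|[|[|//]]] lti]; [constructor 1|constructor 2|constructor 3];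
    apply: val_inj.
have entries := (p0, q0, r0, so3_diag, so3_entry _ 1 0, so3_entry _ 0 2%:R,
  so3_entry _ 2%:R 1, oppr0).
by apply: val_inj; apply/matrixP=> i j; rewrite [RHS]mxE;
  case: (ord3 i) => ->; case: (ord3 j) => ->; rewrite !entries.
Qed.

Lemma of_so3_surj v : (exists p q r, v = p *: e1 + q *: e2 + r *: e3) ->
  exists A, of_so3 A = v.
Proof.
move=> [p [q [r ->]]].
pose B : 'M[K]_3 :=
  p *: delta_mx 2%:R 1 + q *: delta_mx 0 2%:R + r *: delta_mx 1 0.
have skewB : B - B^T \in skew_space K 3.
  by rewrite skew_spaceE linearB /= trmxK opprB.
exists (Subvs skewB); rewrite /of_so3 /= !mxE /=.
by rewrite !(mulr0, mulr1, addr0, add0r, subr0).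
Qed.
End CrossProduct.

Theorem proposition5p15 (R : realType) (L : lieAlgType R) :
  hyper_simple L -> lie_isomorphic L (so R 3).
Proof.
move=> hL.
have [x [y [z [b [c [[x_neq0 b_neq0 c_neq0] [xy xz yz span]]]]]]] :=
  rotation_basis hL.
have bc_lt0 := rotation_sign hL x_neq0 b_neq0 c_neq0 xy xz yz.
(* The scale s solves s^2 b c = -1, which makes the rescaled brackets cyclic. *)
pose s := Num.sqrt (- (b * c)^-1).
have s2 : s * s * (b * c) = -1.
  rewrite -expr2 sqr_sqrtr ?oppr_ge0 ?invr_le0 ?ltW //.
  by rewrite mulNr mulVf // mulf_neq0.
have s_neq0 : s != 0 by rewrite gt_eqF // sqrtr_gt0 oppr_gt0 invr_lt0.
pose e1 := - b^-1 *: x; pose e2 := s *: y; pose e3 := s *: z.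
have e12 : lie e1 e2 = e3.
  by rewrite /e1 /e2 /e3 lieZl lieZr xy !scalerA; congr (_ *: _); field.
have e31 : lie e3 e1 = e2.
  rewrite /e1 /e2 /e3 lieZl lieZr lie_anti xz -scaleNr !scalerA.
  by congr (_ *: _); field.
have e23 : lie e2 e3 = e1.
  rewrite /e1 /e2 /e3 lieZl lieZr yz !scalerA; congr (_ *: _).
  by apply: (mulfI b_neq0); rewrite mulrN mulfV // -s2; ring.
have e1_neq0 : e1 != 0 by rewrite scaler_eq0 oppr_eq0 invr_eq0 negb_or b_neq0.
pose g := linfun (of_so3 e1 e2 e3).
have g_inj : lker g == 0%VS.
  by apply/lker0P=> A B; rewrite !lfunE; apply: of_so3_inj.
have gK : cancel (g^-1)%VF g.
  move=> v; apply: limg_lfunVK; have [A <-] : exists A, of_so3 e1 e2 e3 A = v.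
    apply: of_so3_surj; have [p [q [r ->]]] := span v.
    exists (- p * b), (q / s), (r / s); rewrite /e1 /e2 /e3 !scalerA !divfK //.
    by congr (_ *: _ + _ + _); field.
  by rewrite -[of_so3 _ _ _ A]lfunE memv_img ?memvf.
exists (g^-1)%VF; split; first by exists g => //; apply: lker0_lfunK.
move=> u v; have /lker0P inj_g := g_inj; apply: inj_g.
rewrite gK [RHS]lfunE /= of_so3_lie // -[of_so3 _ _ _ (_ u)]lfunE.
by rewrite -[of_so3 _ _ _ (_ v)]lfunE !gK.
Qed.
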